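(* Let $(R,\mathfrak m,k)$ be a *local ring with $k=R/\mathfrak m$ a field, and let $n\ge 1$ be an integer. If $M$ is a *Artinian graded $R$-module, then $M^{(n)}$ has finite *Bass numbers over $R^{(n)}$.
   Context: All rings are commutative and Noetherian with identity; graded means $\mathbb Z$-graded. A *local ring is a graded ring with a unique maximal element $\mathfrak m$ among its proper graded ideals. A graded module is *Artinian if it satisfies the descending chain condition on graded submodules. $R^{(n)}=\bigoplus_{n\mid i}R_i\subseteq R$, and $M^{(n)}=\bigoplus_{n\mid i}M_i$ as a graded $R^{(n)}$-module. For a graded ring $S$: a *injective module is an injective object in the category of graded $S$-modules and degree-preserving maps; ${}^*E_S(N)$ is the *injective hull (maximal *essential extension, where $N\subseteq N'$ is *essential if every nonzero graded submodule of $N'$ meets $N$ nontrivially); $N(-z)$ is the shift $[N(-z)]_i=N_{i-z}$. A minimal *injective resolution $E^\bullet$ of $N$ has $E^0={}^*E_S(N)$ and each $E^{i+1}$ the *injective hull of the cokernel of the preceding map. Each $E^i$ decomposes as $\bigoplus_{\mathfrak p,z}{}^*E_S(S/\mathfrak p)(-z)^{{}^*\mu(i,\mathfrak p,z,N)}$ over homogeneous primes $\mathfrak p$ and $z\in\mathbb Z$, and the $i$-th *Bass number of $N$ at $\mathfrak p$ is ${}^*\mu(i,\mathfrak p,N)=\sum_z{}^*\mu(i,\mathfrak p,z,N)$. ''Finite *Bass numbers'' means all ${}^*\mu(i,\mathfrak p,N)$ are finite. *)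

(* Defs.v *)
From HB Require Import structures.
From mathcomp Require Import all_boot all_order all_algebra.
From mathcomp Require Import boolp classical_sets cardinality.

Set Implicit Arguments.
Unset Strict Implicit.
Unset Printing Implicit Defensive.

Import Order.TTheory GRing.Theory Num.Theory.

Local Open Scope classical_set_scope.
Local Open Scope ring_scope.

(* A decomposition V = \bigoplus_(i : int) V_i of an abelian group is given by
   its projections: [c i x] is the degree i component of x and
   V_i = [set x | c i x = x]. The second clause makes the c i orthogonal
   idempotents, the third one says that every element is a finite sum of
   homogeneous elements. *)
Definition is_grading (V : zmodType) (c : int -> V -> V) : Prop :=
  [/\ forall i x y, c i (x - y) = c i x - c i y,
      forall i j x, c i (c j x) = if i == j then c j x else 0 &
      forall x, exists2 s : seq int, uniq s & x = \sum_(i <- s) c i x].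

Definition homog (V : zmodType) (c : int -> V -> V) (i : int) : set V :=
  [set x | c i x = x].

Record gradedRing := GradedRing {
  gring_sort :> comNzRingType;
  gring_comp : int -> gring_sort -> gring_sort;
  gring_grading : is_grading gring_comp;
  gring_one : homog gring_comp 0 1;
  gring_mul : forall i j x y,
    homog gring_comp i x -> homog gring_comp j y ->
    homog gring_comp (i + j) (x * y) }.

Record gradedModule (S : gradedRing) := GradedModule {
  gmod_sort :> lmodType S;
  gmod_comp : int -> gmod_sort -> gmod_sort;
  gmod_grading : is_grading gmod_comp;
  gmod_scale : forall i j (a : S) x,
    homog (@gring_comp S) i a -> homog gmod_comp j x ->
    homog gmod_comp (i + j) (a *: x) }.

Arguments gmod_comp {S} M : rename.

Section GradingTheory.
Variables (V : zmodType) (c : int -> V -> V).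
Hypothesis cG : is_grading c.

Lemma grading0 i : c i 0 = 0.
Proof. by case: cG => cB _ _; rewrite -{1}(subrr 0) cB subrr. Qed.

Lemma gradingN i x : c i (- x) = - c i x.
Proof. by case: cG => cB _ _; rewrite -sub0r cB grading0 sub0r. Qed.

Lemma gradingD i x y : c i (x + y) = c i x + c i y.
Proof. by case: cG => cB _ _; rewrite -{1}[y]opprK cB gradingN opprK. Qed.

Lemma grading_sum i (I : Type) (s : seq I) (F : I -> V) :
  c i (\sum_(j <- s) F j) = \sum_(j <- s) c i (F j).
Proof. exact: (big_morph (c i) (gradingD i) (grading0 i)). Qed.

Lemma grading_homog i x : homog c i (c i x).
Proof. by case: cG => _ cc _; rewrite /homog /= cc eqxx. Qed.

Lemma homog_comp i j x : homog c j x -> i != j -> c i x = 0.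
Proof. by case: cG => _ cc _ <- /negbTE ij; rewrite cc ij. Qed.

(* Membership in \bigoplus_(i | n divides i) V_i. *)
Definition veronese_pred (n : nat) : {pred V} :=
  fun x => `[< forall i : int, ~~ (n%:Z %| i)%Z -> c i x = 0 >].

Lemma veronese_predP n x :
  reflect (forall i : int, ~~ (n%:Z %| i)%Z -> c i x = 0)
          (x \in veronese_pred n).
Proof. exact: asboolP. Qed.

Lemma veronese_zmod_closed n : zmod_closed (veronese_pred n).
Proof.
split=> [|x y /veronese_predP xP /veronese_predP yP]; apply/veronese_predP => i ni.
  exact: grading0.
by case: cG => cB _ _; rewrite cB xP // yP // subrr.
Qed.

Lemma veronese_comp n i x :
  x \in veronese_pred n -> c i x \in veronese_pred n.
Proof.
move=> /veronese_predP xP; apply/veronese_predP => j nj.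
by case: cG => _ -> _; case: eqP => // <-; apply: xP.
Qed.

End GradingTheory.

Lemma veronese_scale (S : gradedRing) (M : gradedModule S) n (a : S) (x : M) :
  a \in veronese_pred (@gring_comp S) n ->
  x \in veronese_pred (gmod_comp M) n ->
  a *: x \in veronese_pred (gmod_comp M) n.
Proof.
have gS := gring_grading S; have gM := gmod_grading M.
move=> /veronese_predP aP /veronese_predP xP; apply/veronese_predP => i ni.
have [_ _ /(_ a) [s _ ea]] := gS; have [_ _ /(_ x) [t _ ex]] := gM.
rewrite {1}ea scaler_suml (grading_sum gM) big1_seq // => j _.
rewrite {1}ex scaler_sumr (grading_sum gM) big1_seq // => k _.
have h := gmod_scale (grading_homog gS j a) (grading_homog gM k x).
have [eijk|ijk] := eqVneq i (j + k); last exact: (homog_comp gM h).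
have [nj|nj] := boolP (n%:Z %| j)%Z; last first.
  by rewrite aP // scale0r (grading0 gM).
rewrite (xP k) ?scaler0 ?(grading0 gM) //.
by apply: contra ni => nk; rewrite eijk rpredD.
Qed.

Section RegularModule.
Variable S : gradedRing.

Lemma regular_scale i j (a : S) (x : S^o) :
  homog (@gring_comp S) i a -> homog (@gring_comp S) j x ->
  homog (@gring_comp S) (i + j) (a *: x).
Proof. exact: gring_mul. Qed.

(* S as a graded module over itself. *)
Definition regularModule : gradedModule S :=
  @GradedModule S S^o (@gring_comp S) (gring_grading S) regular_scale.

End RegularModule.

Section Shift.
Variables (S : gradedRing) (N : gradedModule S) (z : int).

Definition shift_comp (i : int) (x : N) : N := gmod_comp N (i - z) x.

Lemma shift_grading : is_grading shift_comp.
Proof.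
have gN := gmod_grading N; case: (gN) => cB cc cs; split.
- by move=> i x y; apply: cB.
- by move=> i j x; rewrite /shift_comp cc (inj_eq (addIr _)).
move=> x; have [s us ex] := cs x; exists [seq i + z | i <- s].
  by rewrite map_inj_uniq //; apply: addIr.
by rewrite big_map {1}ex; apply: eq_bigr => i _; rewrite /shift_comp addrK.
Qed.

Lemma shift_scale i j (a : S) (x : N) :
  homog (@gring_comp S) i a -> homog shift_comp j x ->
  homog shift_comp (i + j) (a *: x).
Proof.
by move=> ha hx; rewrite /homog /shift_comp /= -addrA; apply: gmod_scale.
Qed.

(* N(-z), with [N(-z)]_i = N_(i - z). *)
Definition shiftModule : gradedModule S :=
  @GradedModule S N shift_comp shift_grading shift_scale.

End Shift.

Section VeroneseRing.
Variables (R : gradedRing) (n : nat).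

Definition veronese_ring_pred : {pred R} := veronese_pred (@gring_comp R) n.

Notation P := veronese_ring_pred.

Record veronese_ring := VeroneseRing {
  veronese_ring_val : R;
  veronese_ring_valP : veronese_ring_val \in P }.

HB.instance Definition _ := [isSub for veronese_ring_val].
HB.instance Definition _ := [Choice of veronese_ring by <:].

Lemma veronese_subring_closed : subring_closed P.
Proof.
split.
- apply/veronese_predP => i ni.
  apply: (homog_comp (gring_grading R) (@gring_one R)).
  by apply: contra ni => /eqP ->; rewrite dvdz0.
- by have [] := veronese_zmod_closed (gring_grading R) n.
- move=> x y xP yP.
  exact: (@veronese_scale R (regularModule R) n x y).
Qed.

HB.instance Definition _ :=
  GRing.isSubringClosed.Build R P veronese_subring_closed.
HB.instance Definition _ := [SubChoice_isSubComNzRing of veronese_ring by <:].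

Definition veronese_ring_comp (i : int) (x : veronese_ring) : veronese_ring :=
  VeroneseRing (veronese_comp (gring_grading R) i (veronese_ring_valP x)).

Lemma veronese_ring_grading : is_grading veronese_ring_comp.
Proof.
case: (gring_grading R) => cB cc cs; split.
- by move=> i x y; apply: val_inj; rewrite rmorphB /= cB.
- by move=> i j x; apply: val_inj; rewrite /= cc; case: eqP.
move=> x; have [s us ex] := cs (val x); exists s => //.
by apply: val_inj; rewrite rmorph_sum /=.
Qed.

Lemma veronese_ring_homog i (x : veronese_ring) :
  homog veronese_ring_comp i x <-> homog (@gring_comp R) i (val x).
Proof. by split=> [/(congr1 val)//|h]; apply: val_inj. Qed.

Lemma veronese_ring_one : homog veronese_ring_comp 0 1.
Proof. by apply/veronese_ring_homog; exact: gring_one. Qed.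

Lemma veronese_ring_mul i j (x y : veronese_ring) :
  homog veronese_ring_comp i x -> homog veronese_ring_comp j y ->
  homog veronese_ring_comp (i + j) (x * y).
Proof.
move=> /veronese_ring_homog hx /veronese_ring_homog hy.
by apply/veronese_ring_homog; apply: gring_mul.
Qed.

(* R^(n): degrees are those of R, they are not divided by n. *)
Definition veroneseRing : gradedRing :=
  @GradedRing veronese_ring veronese_ring_comp veronese_ring_grading
    veronese_ring_one veronese_ring_mul.

End VeroneseRing.

Section VeroneseModule.
Variables (R : gradedRing) (n : nat) (M : gradedModule R).

Definition veronese_mod_pred : {pred M} := veronese_pred (gmod_comp M) n.

Notation P := veronese_mod_pred.

Record veronese_mod := VeroneseMod {
  veronese_mod_val : M;
  veronese_mod_valP : veronese_mod_val \in P }.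

HB.instance Definition _ := [isSub for veronese_mod_val].
HB.instance Definition _ := [Choice of veronese_mod by <:].
HB.instance Definition _ :=
  GRing.isZmodClosed.Build M P (veronese_zmod_closed (gmod_grading M) n).
HB.instance Definition _ := [SubChoice_isSubZmodule of veronese_mod by <:].

Definition veronese_mod_scale (a : veroneseRing R n) (x : veronese_mod) :=
  VeroneseMod
    (veronese_scale (veronese_ring_valP a) (veronese_mod_valP x)).

Lemma veronese_mod_scalerA a b x :
  veronese_mod_scale a (veronese_mod_scale b x) = veronese_mod_scale (a * b) x.
Proof. by apply: val_inj; rewrite /= scalerA. Qed.

Lemma veronese_mod_scale1r : left_id 1 veronese_mod_scale.
Proof. by move=> x; apply: val_inj; rewrite /= scale1r. Qed.

Lemma veronese_mod_scalerDr : right_distributive veronese_mod_scale +%R.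
Proof. by move=> a x y; apply: val_inj; rewrite /= scalerDr. Qed.

Lemma veronese_mod_scalerDl x :
  {morph veronese_mod_scale^~ x : a b / a + b}.
Proof. by move=> a b; apply: val_inj; rewrite /= scalerDl. Qed.

HB.instance Definition _ :=
  GRing.Zmodule_isLmodule.Build (veroneseRing R n) veronese_mod
    veronese_mod_scalerA veronese_mod_scale1r
    veronese_mod_scalerDr veronese_mod_scalerDl.

Definition veronese_mod_comp (i : int) (x : veronese_mod) : veronese_mod :=
  VeroneseMod (veronese_comp (gmod_grading M) i (veronese_mod_valP x)).

Lemma veronese_mod_grading : is_grading veronese_mod_comp.
Proof.
case: (gmod_grading M) => cB cc cs; split.
- by move=> i x y; apply: val_inj; rewrite raddfB /= cB.
- by move=> i j x; apply: val_inj; rewrite /= cc; case: eqP.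
move=> x; have [s us ex] := cs (val x); exists s => //.
by apply: val_inj; rewrite raddf_sum /=.
Qed.

Lemma veronese_mod_homog i (x : veronese_mod) :
  homog veronese_mod_comp i x <-> homog (gmod_comp M) i (val x).
Proof. by split=> [/(congr1 val)//|h]; apply: val_inj. Qed.

Lemma veronese_mod_scale_homog i j (a : veroneseRing R n) (x : veronese_mod) :
  homog (@gring_comp (veroneseRing R n)) i a -> homog veronese_mod_comp j x ->
  homog veronese_mod_comp (i + j) (a *: x).
Proof.
move=> /veronese_ring_homog ha /veronese_mod_homog hx.
by apply/veronese_mod_homog; apply: gmod_scale.
Qed.

(* M^(n), as a graded R^(n)-module. *)
Definition veroneseModule : gradedModule (veroneseRing R n) :=
  @GradedModule (veroneseRing R n) veronese_mod veronese_mod_comp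
    veronese_mod_grading veronese_mod_scale_homog.

End VeroneseModule.

Definition submodule (S : pzRingType) (M : lmodType S) (U : set M) : Prop :=
  [/\ U 0, forall x y, U x -> U y -> U (x + y) &
      forall a x, U x -> U (a *: x)].

Definition graded_submodule (S : gradedRing) (M : gradedModule S) (U : set M) :
  Prop := submodule U /\ forall i x, U x -> U (gmod_comp M i x).

Definition ideal (S : comNzRingType) (I : set S) : Prop :=
  submodule (I : set S^o).

Definition graded_ideal (S : gradedRing) (I : set S) : Prop :=
  graded_submodule (I : set (regularModule S)).

Definition noetherian (S : comNzRingType) : Prop :=
  forall I : nat -> set S,
    (forall t, ideal (I t)) -> (forall t, I t `<=` I t.+1) ->
    exists t0, forall t, (t0 <= t)%N -> I t = I t0.

Definition star_artinian (S : gradedRing) (M : gradedModule S) : Prop :=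
  forall U : nat -> set M,
    (forall t, graded_submodule (U t)) -> (forall t, U t.+1 `<=` U t) ->
    exists t0, forall t, (t0 <= t)%N -> U t = U t0.

Definition proper_graded_ideal (S : gradedRing) (I : set S) : Prop :=
  graded_ideal I /\ I <> setT.

Definition maximal_graded_ideal (S : gradedRing) (m : set S) : Prop :=
  proper_graded_ideal m /\
  forall I, proper_graded_ideal I -> m `<=` I -> I = m.

Definition star_local (S : gradedRing) (m : set S) : Prop :=
  maximal_graded_ideal m /\ forall m', maximal_graded_ideal m' -> m' = m.

(* S/I is a field: it is nonzero and each of its nonzero classes has an
   inverse. *)
Definition quotient_field (S : comNzRingType) (I : set S) : Prop :=
  ~ I 1 /\ forall x, ~ I x -> exists y, I (x * y - 1).

Definition graded_prime (S : gradedRing) (p : set S) : Prop :=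
  proper_graded_ideal p /\ forall x y, p (x * y) -> p x \/ p y.

Section GradedMaps.
Variable S : gradedRing.

Definition degree_preserving (A B : gradedModule S) (f : {linear A -> B}) :
  Prop := forall i x, f (gmod_comp A i x) = gmod_comp B i (f x).

Definition star_injective (E : gradedModule S) : Prop :=
  forall (A B : gradedModule S) (f : {linear A -> B}) (g : {linear A -> E}),
    degree_preserving f -> injective f -> degree_preserving g ->
    exists2 h : {linear B -> E}, degree_preserving h & forall a, h (f a) = g a.

(* The extension N <= N' of graded modules, N being a submodule of N'. *)
Definition star_essential (N' : gradedModule S) (N : set N') : Prop :=
  forall U : set N', graded_submodule U -> (exists2 u, U u & u != 0) ->
    exists2 x, U x /\ N x & x != 0.

(* f embeds N in E as a maximal *essential extension: no graded module E'
   properly containing E is a *essential extension of N. *)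
Definition star_injective_hull (N E : gradedModule S) (f : {linear N -> E}) :
  Prop :=
  [/\ degree_preserving f, injective f, star_essential (range f) &
      forall (E' : gradedModule S) (g : {linear E -> E'}),
        degree_preserving g -> injective g ->
        star_essential (range (g \o f)) -> range g = setT].

(* q identifies Q with the quotient of M by U. *)
Definition is_quotient (M : gradedModule S) (U : set M) (Q : gradedModule S)
    (q : {linear M -> Q}) : Prop :=
  [/\ degree_preserving q, range q = setT & forall x, q x = 0 <-> U x].

(* The map d is A -> coker f -> E, where the second map is a *injective
   hull of coker f. *)
Definition hull_of_cokernel (B A E : gradedModule S) (f : {linear B -> A})
    (d : {linear A -> E}) : Prop :=
  exists (C : gradedModule S) (q : {linear A -> C}) (h : {linear C -> E}),
    [/\ is_quotient (range f) q, star_injective_hull h &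
        forall x, d x = h (q x)].

Definition minimal_star_injective_resolution (N : gradedModule S)
    (E : nat -> gradedModule S) (eps : {linear N -> E 0%N})
    (d : forall i, {linear E i -> E i.+1}) : Prop :=
  [/\ forall i, star_injective (E i),
      star_injective_hull eps,
      hull_of_cokernel eps (d 0%N) &
      forall i, hull_of_cokernel (d i) (d i.+1)].

(* E is a copy of the *injective hull of S/p. *)
Definition is_hull_of_prime (p : set S) (E : gradedModule S) : Prop :=
  exists (Q : gradedModule S) (q : {linear regularModule S -> Q})
         (h : {linear Q -> E}),
    is_quotient (p : set (regularModule S)) q /\ star_injective_hull h.

(* E is the direct sum of the F j along the maps f j. *)
Definition is_direct_sum (J : choiceType) (F : J -> gradedModule S)
    (E : gradedModule S) (f : forall j, {linear F j -> E}) : Prop :=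
  [/\ forall j, degree_preserving (f j),
      forall x, exists (s : seq J) (y : forall j, F j),
        uniq s /\ x = \sum_(j <- s) f j (y j) &
      forall (s : seq J) (y : forall j, F j), uniq s ->
        \sum_(j <- s) f j (y j) = 0 -> forall j, j \in s -> y j = 0].

(* A decomposition E = \bigoplus_(j : J) *E(S/p_j)(-z_j) with all p_j
   homogeneous primes. The multiplicity of *E(S/p)(-z) in it is the cardinal of
   [set j | P j = p /\ z j = z]. *)
Definition star_decomposition (E : gradedModule S) (J : choiceType)
    (P : J -> set S) (z : J -> int) : Prop :=
  exists (F : J -> gradedModule S)
         (f : forall j, {linear shiftModule (F j) (z j) -> E}),
    [/\ forall j, graded_prime (P j),
        forall j, is_hull_of_prime (P j) (F j) &
        is_direct_sum f].

(* The i-th *Bass number of N at p is the sum over all z of the multiplicities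
   of *E(S/p)(-z) in E i, hence the cardinal of [set j | P j = p]. Minimal
   *injective resolutions and decompositions of their terms are unique only up
   to isomorphism, so all of them are considered. *)
Definition finite_star_bass_numbers (N : gradedModule S) : Prop :=
  forall (E : nat -> gradedModule S) (eps : {linear N -> E 0%N})
         (d : forall i, {linear E i -> E i.+1}),
    minimal_star_injective_resolution eps d ->
    forall (i : nat) (J : choiceType) (P : J -> set S) (z : J -> int),
      star_decomposition (E i) P z ->
      forall p, graded_prime p -> finite_set [set j | P j = p].

End GradedMaps.

(* Main.v *)
(* Every term of the resolution is *Artinian, and a *Artinian module cannot be
   a direct sum of infinitely many nonzero modules. Over a Noetherian *local
   ring with maximal ideal m, a module E is *Artinian as soon as it is m-torsion
   and (0 :_E m) is *Artinian (Melkersson), so no Matlis duality is needed. Both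
   conditions pass from a *Artinian module N to an *essential extension E of N:
   essentiality carries over m-torsion and forces (0 :_E m) to lie in N.
   Chain conditions descend from R to R^(n) because every graded
   R^(n)-submodule U of M^(n) is contracted from a graded R-submodule of M. *)
Require Import Defs.
From mathcomp Require Import all_boot all_order all_algebra.
From mathcomp Require Import boolp classical_sets cardinality.

Set Implicit Arguments.
Unset Strict Implicit.
Unset Printing Implicit Defensive.

Import Order.TTheory GRing.Theory Num.Theory.

Local Open Scope classical_set_scope.
Local Open Scope ring_scope.

(** * Dependent choice and decreasing sequences of sets *)

Lemma dependent_choice_in (T : Type) (P : set T) (r : T -> T -> Prop) (x0 : T) :
  P x0 -> (forall x, P x -> exists2 y, P y & r x y) ->
  exists f : nat -> T, forall t, P (f t) /\ r (f t) (f t.+1).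
Proof.
move=> P0 Pr.
have [g gP] : {g : T -> T & forall x, P x -> P (g x) /\ r x (g x)}.
  apply: (boolp.choice (P := fun x y => P x -> P y /\ r x y)) => x.
  have [/Pr[y Py rxy]|nPx] := pselect (P x); first by exists y.
  by exists x.
have Pf t : P (iter t g x0) by elim: t => //= t /gP[].
by exists (fun t => iter t g x0) => t; split=> //; have [] := gP _ (Pf t).
Qed.

Lemma chain_le (T : Type) (U : nat -> set T) :
  (forall t, U t.+1 `<=` U t) -> forall s t, (s <= t)%N -> U t `<=` U s.
Proof.
move=> dU s t; elim: t => [|t IH]; first by rewrite leqn0 => /eqP ->.
rewrite leq_eqVlt => /predU1P[->//|]; rewrite ltnS => /IH.
by apply: subset_trans; apply: dU.
Qed.

(** * Graded submodules and descending chain conditions *)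

Section GradedModules.
Variable S : gradedRing.
Implicit Types M N E : gradedModule S.
Notation comp := (@gring_comp S).

Lemma homogX (x : S) d k : homog comp d x -> homog comp (d *+ k) (x ^+ k).
Proof.
move=> hx; elim: k => [|k IH]; first exact: gring_one.
by rewrite exprS mulrS; apply: gring_mul.
Qed.

(** Multiplication by [a] raises degrees by [i], so only the component of [x] in degree [j - i]
    contributes to degree [j]. *)
Lemma comp_scalel M (a : S) i j (x : M) : homog comp i a ->
  gmod_comp M j (a *: x) = a *: gmod_comp M (j - i) x.
Proof.
move=> ha; have gM := gmod_grading M; have [_ cc /(_ x)[s _ ex]] := gM.
rewrite {1 2}ex scaler_sumr !(grading_sum gM) scaler_sumr.
apply: eq_bigr => k _; have := gmod_scale ha (grading_homog gM k x).
rewrite cc subr_eq [i + k]addrC => h; have [->|jk] := eqVneq; first exact: h.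
by rewrite (homog_comp gM h) ?scaler0.
Qed.

Lemma comp_scaler M (a : S) i j (x : M) : homog (gmod_comp M) i x ->
  gmod_comp M j (a *: x) = comp (j - i) a *: x.
Proof.
move=> hx; have gM := gmod_grading M; have gS := gring_grading S.
have [_ cc /(_ a)[s _ ea]] := gS.
rewrite {1 2}ea scaler_suml (grading_sum gM) (grading_sum gS) scaler_suml.
apply: eq_bigr => k _; have h := gmod_scale (grading_homog gS k a) hx.
rewrite cc subr_eq; have [->|jk] := eqVneq; first exact: h.
by rewrite (homog_comp gM h) ?scale0r.
Qed.

Lemma submodule_sum M (U : set M) (I : Type) (s : seq I) (F : I -> M) :
  submodule U -> (forall i, U (F i)) -> U (\sum_(i <- s) F i).
Proof.
case=> U0 UD _ UF; elim: s => [|i s IH]; first by rewrite big_nil.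
by rewrite big_cons; apply: UD.
Qed.

Lemma submoduleB M (U : set M) : submodule U ->
  forall x y, U x -> U y -> U (x - y).
Proof. by case=> _ UD UZ x y Ux Uy; rewrite -scaleN1r; apply/UD/UZ. Qed.

Lemma submodule_comps M (U : set M) (x : M) :
  submodule U -> (forall i, U (gmod_comp M i x)) -> U x.
Proof.
move=> sU Uc; have [_ _ /(_ x)[s _ ->]] := gmod_grading M.
exact: submodule_sum.
Qed.

Lemma graded_submoduleI M (A B : set M) :
  graded_submodule A -> graded_submodule B -> graded_submodule (A `&` B).
Proof.
move=> [[A0 AD AZ] Ac] [[B0 BD BZ] Bc]; split; last first.
  by move=> i x [/Ac ? /Bc ?].
split=> // [x y [? ?] [? ?]|a x [? ?]]; first by split; [apply: AD|apply: BD].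
by split; [apply: AZ|apply: BZ].
Qed.

Lemma graded_submodule_preimage M N (f : {linear M -> N}) (U : set N) :
  degree_preserving f -> graded_submodule U -> graded_submodule (f @^-1` U).
Proof.
move=> df [[U0 UD UZ] Uc]; split=> [|i x Ux]; last by rewrite /= df; apply: Uc.
by split=> [|x y ? ?|a x ?] /=; rewrite ?linear0 ?linearD ?linearZ//;
  [apply: UD|apply: UZ].
Qed.

Lemma graded_submodule_range M N (f : {linear M -> N}) :
  degree_preserving f -> graded_submodule (range f).
Proof.
move=> df; split; last by move=> i _ [x _ <-]; exists (gmod_comp M i x).
split=> [|_ _ [x _ <-] [y _ <-]|a _ [x _ <-]].
- by exists 0 => //; rewrite linear0.
- by exists (x + y) => //; rewrite linearD.
- by exists (a *: x) => //; rewrite linearZ.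
Qed.

Lemma graded_submodule_cyclic M (x : M) i : homog (gmod_comp M) i x ->
  graded_submodule [set a *: x | a in [set: S]].
Proof.
move=> hx; split; last first.
  by move=> j _ [a _ <-]; exists (comp (j - i) a); rewrite ?(comp_scaler _ _ hx).
split=> [|_ _ [a _ <-] [b _ <-]|b _ [a _ <-]].
- by exists 0 => //; rewrite scale0r.
- by exists (a + b) => //; rewrite scalerDl.
- by exists (b * a) => //; rewrite scalerA.
Qed.

Lemma graded_submodule_killed M (x : S) d : homog comp d x ->
  graded_submodule [set y : M | x *: y = 0].
Proof.
move=> hx; split=> [|i y /= xy0].
  split=> [|y z /= y0 z0|a y /= y0]; first exact: scaler0.
    by rewrite scalerDr y0 z0 addr0.
  by rewrite scalerA mulrC -scalerA y0 scaler0.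
have := comp_scalel (d + i) y hx.
by rewrite xy0 (grading0 (gmod_grading M)) addrAC subrr add0r.
Qed.

Lemma graded_ideal_ann M (e : M) i : homog (gmod_comp M) i e ->
  graded_ideal [set a : S | a *: e = 0].
Proof.
move=> he; split=> [|j a /= ae].
  split=> [|a b /= a0 b0|a b /= b0]; first exact: scale0r.
    by rewrite scalerDl a0 b0 addr0.
  by rewrite -scalerA b0 scaler0.
by rewrite -[j](addrK i) -(comp_scaler _ _ he) ae (grading0 (gmod_grading M)).
Qed.

(** Every element is a finite sum of homogeneous ones, and the exponents of the terms can be added
    up. *)
Lemma torsion_homog M (x : S) :
  (forall i (e : M), homog (gmod_comp M) i e -> exists k, x ^+ k *: e = 0) ->
  forall e : M, exists k, x ^+ k *: e = 0.
Proof.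
move=> hom e; have gM := gmod_grading M; have [_ _ /(_ e)[s _ ->]] := gM.
elim: s => [|i s [k IH]]; first by exists 0%N; rewrite big_nil scaler0.
have [l el] := hom i _ (grading_homog gM i e).
exists (k + l)%N; rewrite big_cons scalerDr exprD -!scalerA el scaler0 add0r.
by rewrite scalerA mulrC -scalerA IH scaler0.
Qed.

(** The bound [A] is an arbitrary set, so annihilators and ranges need not be turned into graded
    modules. *)
Definition dcc_in M (A : set M) : Prop :=
  forall U : nat -> set M, (forall t, graded_submodule (U t)) ->
    (forall t, U t.+1 `<=` U t) -> (forall t, U t `<=` A) ->
    exists t0, forall t, (t0 <= t)%N -> U t = U t0.

Lemma star_artinian_dcc M : star_artinian M <-> dcc_in [set: M].
Proof. by split=> h U gU dU => [_|]; apply: h. Qed.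

Lemma dcc_in_sub M (A B : set M) : A `<=` B -> dcc_in B -> dcc_in A.
Proof.
by move=> AB hB U gU dU UA; apply: hB => // t; apply: subset_trans AB.
Qed.

(** A submodule inside the range is determined by its preimage. *)
Lemma dcc_in_range M N (f : {linear M -> N}) :
  degree_preserving f -> star_artinian M -> dcc_in (range f).
Proof.
move=> df aM U gU dU Uf.
have [t||t0 tP] := aM (fun t => f @^-1` U t).
- exact: graded_submodule_preimage.
- by move=> t x; apply: dU.
exists t0 => t /tP e; apply/seteqP; split=> y Uy; have [x _ fx] := Uf _ _ Uy;
  move: Uy; rewrite -fx.
  by rewrite -[U t (f x)]/((f @^-1` U t) x) e.
by rewrite -[U t0 (f x)]/((f @^-1` U t0) x) -e.
Qed.

(* Melkersson's criterion: the submodules x^k L `&` (0 : x), k >= 0, determine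
   L among the x-torsion submodules ordered by inclusion, and a decreasing
   double sequence in (0 : x) is eventually constant, uniformly in k. *)
Lemma dcc_in_torsion M (A : set M) (x : S) d : homog comp d x ->
  (forall e, A e -> exists k, x ^+ k *: e = 0) ->
  dcc_in (A `&` [set y | x *: y = 0]) -> dcc_in A.
Proof.
move=> hx tA aK U gU dU UA.
pose V k t := [set y : M | x *: y = 0 /\ exists2 l, U t l & y = x ^+ k *: l].
have gV k t : graded_submodule (V k t).
  apply: graded_submoduleI; first exact: graded_submodule_killed hx.
  have [[U0 UD UZ] Uc] := gU t; split; last first.
    move=> i _ [l Ul ->]; rewrite (comp_scalel _ _ (homogX k hx)).
    by exists (gmod_comp M (i - d *+ k) l) => //; apply: Uc.
  split=> [|_ _ [y Uy ->] [z Uz ->]|a _ [y Uy ->]].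
  - by exists 0 => //; rewrite scaler0.
  - by exists (y + z); [apply: UD|rewrite scalerDr].
  - by exists (a *: y); [apply: UZ|rewrite !scalerA mulrC].
have VA k t : V k t `<=` A `&` [set y | x *: y = 0].
  move=> y [x0 [l Ul yl]]; split=> //; apply: (UA t); rewrite yl.
  by have [[_ _ UZ] _] := gU t; apply: UZ.
have dVt k t : V k t.+1 `<=` V k t.
  by move=> y [x0 [l Ul yl]]; split=> //; exists l => //; apply: dU.
have dVk k t : V k.+1 t `<=` V k t.
  move=> y [x0 [l Ul yl]]; split=> //.
  exists (x *: l); last by rewrite scalerA -exprSr.
  by have [[_ _ UZ] _] := gU t; apply: UZ.
have dV t : V t.+1 t.+1 `<=` V t t by apply: subset_trans (@dVk _ _).
have [t0 t0P] := aK (fun t => V t t) (fun t => gV t t) dV (fun t => @VA t t).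
(* [V k t] lies between the diagonal terms at [t0] and at [maxn k t], which agree. *)
have Vt0 k t : (t0 <= k)%N -> (t0 <= t)%N -> V k t = V t0 t0.
  move=> k0 t1; apply/seteqP; split.
    apply: subset_trans (chain_le (dVt k) t1) _.
    exact: (chain_le (U := V^~ t0)).
  rewrite -(t0P (maxn k t)) ?leq_max ?k0 //.
  apply: subset_trans (chain_le (dVt _) (leq_maxr k t)) _.
  exact: (chain_le (U := V^~ t)) (leq_maxl k t).
(* The remaining rows [k < t0] are finitely many, so one bound [T] serves them all. *)
have [T TP] : exists T, forall k t, (k < t0)%N -> (T <= t)%N -> V k t = V k T.
  elim: (t0) => [|k0 [T IH]]; first by exists 0%N.
  have [T' T'P] := aK (V k0) (gV k0) (dVt k0) (@VA k0).
  exists (maxn T T') => k t; rewrite ltnS leq_eqVlt geq_max => kk0 /andP[Tt T't].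
  case/predU1P: kk0 => [->|kk0]; first by rewrite !T'P // leq_maxr.
  by rewrite (IH k t) // (IH k (maxn _ _)) // leq_maxl.
exists (maxn T t0) => t; rewrite geq_max => /andP[Tt t0t].
have VE k : V k t = V k (maxn T t0).
  have [kt0|t0k] := ltnP k t0; last by rewrite !Vt0 // leq_maxr.
  by rewrite (TP k t) // (TP k (maxn _ _)) // leq_maxl.
have Utm : U t `<=` U (maxn T t0) by apply: (chain_le dU); rewrite geq_max Tt.
apply/seteqP; split=> // y Uy; have [k] := tA _ (UA _ _ Uy).
(* If [x ^+ k.+1] kills [y], then [x ^+ k *: y = x ^+ k *: l] for some [l] in [U t], and induction
   applies to [y - l]. *)
elim: k y Uy => [|k IH] y Uy.
  by rewrite expr0 scale1r => ->; have [[]] := gU t.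
move=> xk.
have : V k (maxn T t0) (x ^+ k *: y).
  by split; [rewrite scalerA -exprS|exists y].
rewrite -VE => -[_ [l Ul yl]].
rewrite -[y](subrK l); have [sU _] := gU t; have [_ UD _] := sU; apply: UD => //.
apply: IH; last by rewrite scalerBr yl subrr.
by apply: submoduleB (Utm _ Ul) => //; have [] := gU (maxn T t0).
Qed.

End GradedModules.

(** * The ascending chain condition on graded ideals *)

Definition graded_acc (S : gradedRing) : Prop :=
  forall I : nat -> set S, (forall t, graded_ideal (I t)) ->
    (forall t, I t `<=` I t.+1) ->
    exists t0, forall t, (t0 <= t)%N -> I t = I t0.

(** Otherwise dependent choice builds a strictly increasing chain of graded ideals. *)
Lemma graded_acc_max (S : gradedRing) (Q : set S -> Prop) (I0 : set S) :
  graded_acc S -> graded_ideal I0 -> Q I0 ->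
  exists I, [/\ graded_ideal I, Q I &
    forall I', graded_ideal I' -> Q I' -> I `<=` I' -> I' = I].
Proof.
move=> acc gI0 QI0; apply: contrapT => nmax.
pose P := [set I : set S | graded_ideal I /\ Q I].
have [//|I [gI QI]|f fP] :=
    @dependent_choice_in _ P (fun I I' => I `<=` I' /\ I' <> I) I0.
  apply: contrapT => nI; apply: nmax; exists I; split=> // I' gI' QI' II'.
  by apply: contrapT => ne; apply: nI; exists I'.
have [t|t|t0 /(_ t0.+1 (leqnSn _))] := acc f.
- by have [[]] := fP t.
- by have [_ []] := fP t.
by have [_ []] := fP t0.
Qed.

(** * Artinian modules and their essential extensions when homogeneous elements outside [m] are
    units *)

Section StarLocal.
Variables (S : gradedRing) (m : set S).
Hypothesis S_acc : graded_acc S.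
Hypothesis m_graded : graded_ideal m.
Hypothesis m1 : ~ m 1.
Hypothesis m_unit :
  forall i a, homog (@gring_comp S) i a -> ~ m a -> exists b, b * a = 1.
Implicit Types M N E : gradedModule S.
Notation comp := (@gring_comp S).

(** In place of an induction on generators of [m], a maximal ideal with property [Q] is enlarged by
    a homogeneous element of [m], using [dcc_in_torsion]. *)
Lemma dcc_in_ann E :
  (forall (x : S) d, m x -> homog comp d x ->
     forall e : E, exists k, x ^+ k *: e = 0) ->
  dcc_in [set e : E | forall a, m a -> a *: e = 0] -> dcc_in [set: E].
Proof.
move=> tE dm.
pose ann (I : set S) := [set e : E | forall a, I a -> a *: e = 0].
have annG I : graded_ideal I -> graded_submodule (ann I).
  move=> [sI Ic]; split=> [|i e /= Ie a Ia].
    split=> [a _|e e' /= Ie Ie' a Ia|b e /= Ie a Ia]; first exact: scaler0.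
      by rewrite scalerDr Ie // Ie' // addr0.
    by rewrite scalerA mulrC -scalerA Ie // scaler0.
  have [_ _ /(_ a)[s _ ->]] := gring_grading S.
  rewrite scaler_suml big1_seq // => j _.
  have := comp_scalel (j + i) e (grading_homog (gring_grading S) j a).
  rewrite (Ie _ (Ic j a Ia)) (grading0 (gmod_grading E)).
  by rewrite addrAC subrr add0r => <-.
(* [Q] holds for the zero ideal, whose annihilator is all of [E]; for [I = m] it is the claim. *)
pose Q I := I `<=` m /\ (dcc_in (ann I) -> dcc_in [set: E]).
have [||I [gI [Im QI] maxI]] := @graded_acc_max S Q [set 0] S_acc.
- split=> [|i x ->]; last exact: grading0 (gring_grading S) i.
  split=> // [x y -> ->|a x ->]; first by rewrite addr0.
  by rewrite scaler0.
- split=> [x ->|]; first by have [[]] := m_graded.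
  by apply: dcc_in_sub => e _ a ->; rewrite scale0r.
suff mI : m `<=` I by apply: QI; apply: dcc_in_sub dm => e Ie a /mI; apply: Ie.
apply: contrapT => nmI.
have [x [d [mx hx nIx]]] : exists x d, [/\ m x, homog comp d x & ~ I x].
  apply: contrapT => nx; apply: nmI => x mx; have [sI _] := gI.
  apply: (submodule_comps (M := regularModule S)) sI _ => i.
  apply: contrapT => nIx; apply: nx; exists (comp i x), i; split=> //.
    by have [_ mc] := m_graded; apply: mc.
  exact: grading_homog (gring_grading S) i x.
(* The annihilator of [I' = I + (x)] contains the part of [ann I] killed by [x]. *)
pose I' := [set a + b * x | a in I & b in [set: S]].
have [[I0 ID IZ] Ic] := gI.
have II' : I `<=` I'
  by move=> a Ia; exists a => //; exists 0; rewrite // mul0r addr0.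
have I'x : I' x by exists 0 => //; exists 1; rewrite // mul1r add0r.
have gI' : graded_ideal I'.
  split=> [|i _ [a Ia] [b _] <-].
    split; first exact: II'.
      move=> _ _ [a Ia] [b _] <- [a' Ia'] [b' _] <-.
      exists (a + a'); first exact: ID.
      by exists (b + b') => //; rewrite mulrDl addrACA.
    move=> c _ [a Ia] [b _] <-; exists (c *: (a : S^o)); first exact: IZ.
    by exists (c * b) => //; rewrite scalerDr -mulrA.
  exists (comp i a); first exact: Ic.
  exists (comp (i - d) b) => //=; rewrite (gradingD (gring_grading S)).
  congr (_ + _); symmetry.
  exact: (comp_scaler (M := regularModule S) b i hx).
apply: nIx; rewrite -(maxI I') //; split.
  have [[_ mD mZ] _] := m_graded.
  by move=> _ [a Ia] [b _] <-; apply: mD; [apply: Im|apply: mZ].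
move=> dI'; apply: QI; apply: (dcc_in_torsion hx) => [e _|].
  exact: tE mx hx e.
apply: dcc_in_sub dI' => e [Ie xe] _ [a Ia] [b _] <-.
by rewrite scalerDl Ie // -scalerA xe scaler0 addr0.
Qed.

(** The cyclic submodules generated by the [x ^+ k *: e] stabilize, and an argument in the style of
    Nakayama's lemma shows that one of the generators vanishes. *)
Lemma star_artinian_torsion N (x : S) d (e : N) : star_artinian N ->
  m x -> homog comp d x -> exists k, x ^+ k *: e = 0.
Proof.
move=> aN mx hx.
have gS := gring_grading S; apply: torsion_homog e => i e he.
have hxe k := gmod_scale (homogX k hx) he.
have [t|t _ [a _ <-]|t0 /(_ t0.+1 (leqnSn _))/seteqP[_]] :=
    aN (fun k => [set a *: (x ^+ k *: e) | a in [set: S]]).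
- exact: graded_submodule_cyclic (hxe t).
- by exists (a * x); rewrite // exprS !scalerA mulrA.
move=> /(_ (x ^+ t0 *: e))[]; first by exists 1; rewrite ?scale1r.
move=> a _ ae; exists t0.
(* Both powers of [x] times [e] are homogeneous, so [a] may be replaced by its component of degree
   [- d]. *)
have ce : comp (- d) a *: (x ^+ t0.+1 *: e) = x ^+ t0 *: e.
  have -> : - d = (d *+ t0 + i) - (d *+ t0.+1 + i).
    by rewrite opprD addrACA subrr addr0 mulrS opprD addrCA subrr addr0.
  by rewrite -(comp_scaler _ _ (hxe _)) ae; exact: hxe.
(* This element has degree 0 and is [1] modulo [m], hence a unit; it kills [x ^+ t0 *: e]. *)
have h : homog comp 0 (1 - comp (- d) a * x).
  case: (gS) => cB _ _; rewrite /homog /= cB (gring_one S); congr (_ - _).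
  by rewrite -(addNr d); apply: gring_mul => //; apply: grading_homog.
have [|u ue] := m_unit h.
  have [[_ mD mZ] _] := m_graded; move=> /mD - /(_ _ (mZ (comp (- d) a) _ mx)).
  by rewrite subrK.
rewrite -[LHS]scale1r -ue -scalerA scalerBl scale1r -{1}ce.
by rewrite exprS !scalerA mulrA subrr scaler0.
Qed.

(* If x^k e <> 0 for all k, take k with ann (x^k e) = ann (x^(k+1) e) = ...;
   a nonzero multiple of x^k e lying in N is not x-torsion. *)
Lemma essential_torsion N E (f : {linear N -> E}) (x : S) d (e : E) :
  degree_preserving f -> star_essential (range f) -> star_artinian N ->
  m x -> homog comp d x -> exists k, x ^+ k *: e = 0.
Proof.
move=> df essf aN mx hx.
apply: torsion_homog e => i e he.
have hxe k := gmod_scale (homogX k hx) he.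
have [t|t a /= ae|t0 t0P] :=
    S_acc (I := fun k => [set a : S | a *: (x ^+ k *: e) = 0]).
- exact: graded_ideal_ann (hxe t).
- by rewrite exprS -scalerA scalerA mulrC -scalerA ae scaler0.
exists t0; apply: contrapT => ne0.
have [|y [[a _ <-] [z _ fz]] /eqP nz] :=
    essf _ (graded_submodule_cyclic (hxe t0)).
  by exists (x ^+ t0 *: e); [exists 1; rewrite ?scale1r|apply/eqP].
have [k xz] := star_artinian_torsion z aN mx hx.
(* Since [x ^+ k] kills [z], the coefficient [a] annihilates [x ^+ (k + t0) *: e], hence also
   [x ^+ t0 *: e]. *)
apply: nz; have /seteqP[+ _] := t0P (k + t0)%N (leq_addl _ _); apply => /=.
by rewrite exprD -scalerA scalerA mulrC -scalerA -fz -linearZ xz linear0.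
Qed.

(** By [dcc_in_ann] it remains to place the elements killed by [m] in the image of [N]. A
    homogeneous one has a nonzero multiple there, and some component of the coefficient does not
    kill it; that component is a unit. *)
Lemma star_artinian_essential N E (f : {linear N -> E}) :
  degree_preserving f -> star_essential (range f) ->
  star_artinian N -> star_artinian E.
Proof.
move=> df essf aN; apply/star_artinian_dcc; apply: dcc_in_ann => [x d mx hx e|].
  exact: essential_torsion df essf aN mx hx.
apply: dcc_in_sub (dcc_in_range df aN) => e /= me.
have [sf fc] := graded_submodule_range df; have [_ _ fZ] := sf.
apply: (submodule_comps sf) => i.
have [->|ci0] := eqVneq (gmod_comp E i e) 0; first by case: sf.
have hc := grading_homog (gmod_grading E) i e.
have [|y [[a _ <-] fa] nz] := essf _ (graded_submodule_cyclic hc).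
  by exists (gmod_comp E i e) => //; exists 1; rewrite ?scale1r.
have mc b : m b -> b *: gmod_comp E i e = 0.
  move=> mb; have [_ _ /(_ b)[s _ ->]] := gring_grading S.
  rewrite scaler_suml big1_seq // => j _.
  have := comp_scalel (j + i) e (grading_homog (gring_grading S) j b).
  have [_ mcc] := m_graded; rewrite (me _ (mcc j _ mb)) (grading0 (gmod_grading E)).
  by rewrite addrAC subrr add0r => <-.
have [j nj] : exists j, gmod_comp E j (a *: gmod_comp E i e) <> 0.
  apply: contrapT => nj; move/eqP: nz; apply.
  have [_ _ /(_ (a *: gmod_comp E i e))[s _ ->]] := gmod_grading E.
  by rewrite big1_seq // => j _; apply: contrapT => ?; apply: nj; exists j.
rewrite (comp_scaler _ _ hc) in nj.
have [b bE] : exists b, b * comp (j - i) a = 1.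
  apply: m_unit; first exact: grading_homog (gring_grading S) _ _.
  by move=> /mc.
rewrite -[gmod_comp E i e]scale1r -bE -scalerA; apply: fZ.
by rewrite -(comp_scaler _ _ hc); apply: fc.
Qed.

Lemma star_artinian_quotient M N (U : set M) (q : {linear M -> N}) :
  is_quotient U q -> star_artinian M -> star_artinian N.
Proof.
by case=> dq qT _ aM; apply/star_artinian_dcc; rewrite -qT; apply: dcc_in_range.
Qed.

(** The first term is an essential extension of [N], each later one an essential extension of a
    quotient of its predecessor. *)
Lemma star_artinian_resolution N (E : nat -> gradedModule S)
    (eps : {linear N -> E 0%N}) (d : forall i, {linear E i -> E i.+1}) :
  minimal_star_injective_resolution eps d -> star_artinian N ->
  forall i, star_artinian (E i).
Proof.
move=> [_ [deps _ eeps _] cok0 cokS] aN.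
have cok (B A C : gradedModule S) (f : {linear B -> A}) (g : {linear A -> C}) :
    hull_of_cokernel f g -> star_artinian A -> star_artinian C.
  move=> [Q [q [h [qq [dh _ eh _] _]]]] aA.
  exact: star_artinian_essential dh eh (star_artinian_quotient qq aA).
elim=> [|[|i] IH]; first exact: star_artinian_essential deps eeps aN.
- exact: cok cok0 IH.
- exact: cok (cokS i) IH.
Qed.

End StarLocal.

(** * Finiteness of Artinian direct sums *)

Section DirectSum.
Variables (S : gradedRing) (J : choiceType) (F : J -> gradedModule S).
Variables (E : gradedModule S) (f : forall j, {linear F j -> E}).
Hypothesis f_sum : is_direct_sum f.

(** Padding by zeros lets sums over two different lists be added over a common one. *)
Lemma direct_sum_widen (s t : seq J) (y : forall j, F j) :
  uniq s -> uniq t -> {subset s <= t} ->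
  \sum_(j <- s) f j (y j) = \sum_(j <- t) f j (if j \in s then y j else 0).
Proof.
move=> us ut st; rewrite [RHS](eq_bigr (fun j => if j \in s then f j (y j) else 0)).
  rewrite -big_mkcond -big_filter; apply: perm_big; apply: uniq_perm => //.
    exact: filter_uniq.
  by move=> j; rewrite mem_filter andb_idr //; apply: st.
by move=> j _; case: ifP => // _; rewrite linear0.
Qed.

Definition partial_sum (A : set J) : set E :=
  [set x | exists (s : seq J) (y : forall j, F j),
     [/\ uniq s, forall j, j \in s -> A j & x = \sum_(j <- s) f j (y j)]].

Lemma partial_sum_graded A : graded_submodule (partial_sum A).
Proof.
have [df _ _] := f_sum; split; last first.
  move=> i _ [s [y [us sA ->]]]; exists s, (fun j => gmod_comp (F j) i (y j)).
  split=> //; rewrite (grading_sum (gmod_grading E)).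
  by apply: eq_bigr => j _; rewrite df.
split.
- by exists [::], (fun j => 0); rewrite big_nil.
- move=> _ _ [s [y [us sA ->]]] [t [z [ut tA ->]]].
  exists (undup (s ++ t)).
  exists (fun j => (if j \in s then y j else 0) + (if j \in t then z j else 0)).
  split; first exact: undup_uniq.
    by move=> j; rewrite mem_undup mem_cat => /orP[/sA|/tA].
  under [RHS]eq_bigr do rewrite linearD.
  by rewrite big_split /= -!direct_sum_widen ?undup_uniq // => j;
    rewrite mem_undup mem_cat => ->; rewrite ?orbT.
- move=> a _ [s [y [us sA ->]]]; exists s, (fun j => a *: y j); split=> //.
  by rewrite scaler_sumr; apply: eq_bigr => j _; rewrite linearZ.
Qed.

Lemma partial_sum_summand (A : set J) j (y : F j) :
  partial_sum A (f j y) -> ~ A j -> y = 0.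
Proof.
have [_ _ dirf] := f_sum; move=> [s [z [us sA fy]]] nAj.
have njs : j \notin s by apply/negP => /sA.
(* [w] collects the coefficients of the relation obtained by moving the sum [fy] to the left; [y] is
   cast along [j = k] because [F] depends on the index. *)
pose w k : F k := if pselect (j = k) is left e then ecast k (F k) e y else - z k.
have wj : w j = y.
  by rewrite /w; case: pselect => // e; rewrite (Prop_irrelevance e erefl).
rewrite -wj; apply: (dirf (j :: s)); rewrite ?mem_head //= ?njs //.
rewrite big_cons wj fy -big_split big1_seq //= => k ks.
rewrite /w; case: pselect => [e|_]; last by rewrite linearN subrr.
by rewrite e ks in njs.
Qed.

Lemma partial_sumS (A B : set J) : A `<=` B -> partial_sum A `<=` partial_sum B.
Proof. by move=> AB x [s [y [us sA ->]]]; exists s, y; split=> // j /sA/AB. Qed.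

(** For infinite [J], dropping one index after another gives a strictly decreasing chain of partial
    sums. *)
Lemma star_artinian_finite_direct_sum :
  star_artinian E -> (forall j, exists y : F j, y != 0) -> finite_set [set: J].
Proof.
move=> aE Fn0; apply: contrapT => Jinf.
pose U (s : seq J) := partial_sum [set j | j \notin s].
have [//|s _|g gP] := @dependent_choice_in _ setT
    (fun s t : seq J => U t `<=` U s /\ U s <> U t) [::].
  have [j js] : exists j, j \notin s.
    apply: contrapT => nj; apply: Jinf; apply: (sub_finite_set _ (finite_seq s)).
    by move=> j _ /=; apply: contrapT => /negP ?; apply: nj; exists j.
  exists (j :: s) => //; split.
    by apply: partial_sumS => k /=; rewrite inE negb_or => /andP[].
  have [y y0] := Fn0 j => Us; move/eqP: y0; apply.
  apply: (@partial_sum_summand [set k | k \notin j :: s] j).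
    rewrite -/(U (j :: s)) -Us; exists [:: j].
    pose w k : F k := if pselect (j = k) is left e then ecast k (F k) e y else 0.
    have wj : w j = y.
      by rewrite /w; case: pselect => // e; rewrite (Prop_irrelevance e erefl).
    exists w; split=> // [k|]; first by rewrite inE => /eqP ->.
    by rewrite big_seq1 wj.
  by rewrite /= mem_head.
have [t|t|t0 /(_ t0.+1 (leqnSn _)) e] := aE (fun t => U (g t)).
- exact: partial_sum_graded.
- by have [_ []] := gP t.
by have [_ [_ []]] := gP t0.
Qed.

End DirectSum.

(** * Homogeneous units of a *local ring *)

Lemma graded_ideal_setT (S : gradedRing) (I : set S) :
  graded_ideal I -> I 1 -> I = [set: S].
Proof.
move=> [[_ _ IZ] _] I1; apply/seteqP; split=> // x _.
by rewrite -[x]mulr1; apply: (IZ x 1).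
Qed.

Lemma noetherian_graded_acc (S : gradedRing) : noetherian S -> graded_acc S.
Proof. by move=> nS I gI; apply: nS => t; have [] := gI t. Qed.

Lemma star_local_proper (R : gradedRing) (m : set R) : star_local m -> ~ m 1.
Proof. by move=> [[[gm mT] _] _] /(graded_ideal_setT gm). Qed.

(** If [a] generated a proper ideal, some maximal graded ideal would contain [a], and the only one
    is [m]. *)
Lemma star_local_unit (R : gradedRing) (m : set R) i (a : R) :
  graded_acc R -> star_local m -> homog (@gring_comp R) i a -> ~ m a ->
  exists2 b, homog (@gring_comp R) (- i) b & b * a = 1.
Proof.
move=> acc [_ mU] ha nma.
pose I0 := [set b *: (a : regularModule R) | b in [set: R]].
have gI0 : graded_ideal I0
  by apply: (@graded_submodule_cyclic R (regularModule R) a i).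
have [[b _ ba]|nI1] := pselect (I0 1).
  (* In degree 0, [b * a = 1] involves only the component of [b] of degree [- i]. *)
  have gR := gring_grading R; exists (gring_comp (- i) b).
    exact: grading_homog.
  rewrite -[- i]sub0r; apply: etrans (gring_one R); rewrite -ba.
  by symmetry; apply: (comp_scaler (M := regularModule R) b 0 ha).
have [I [gI [I0I nI] maxI]] := graded_acc_max
  (Q := fun I => I0 `<=` I /\ ~ I 1) acc gI0 (conj (@subset_refl _ I0) nI1).
have mI : maximal_graded_ideal I.
  split; first by split=> // IT; apply: nI; rewrite IT.
  move=> I' [gI' nT] II'; apply: maxI => //; split.
    exact: subset_trans II'.
  by move/(graded_ideal_setT gI').
by case: nma; rewrite -(mU _ mI); apply: I0I; exists 1; rewrite ?scale1r.
Qed.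

(** * Extension and contraction between [R] and its Veronese subring *)

Section Veronese.
Variables (R : gradedRing) (n : nat).
Notation P := (veronese_ring_pred (R := R) n).

Section Extension.
Variables (M : gradedModule R) (U : set M).
Hypothesis U0 : U 0.
Hypothesis UD : forall x y, U x -> U y -> U (x + y).
Hypothesis UZ : forall a x, a \in P -> U x -> U (a *: x).
Hypothesis Uc : forall i x, U x -> U (gmod_comp M i x).

(* A substitute for the R-submodule R U which also contracts to U. *)
Definition veronese_ext : set M :=
  [set x | forall r i, (n%:Z %| i)%Z -> U (gmod_comp M i (r *: x))].

Let gM := gmod_grading M.
Let gR := gring_grading R.

(** For [r] homogeneous, the degree [i] part of [r] times a component of [x] is either zero or the
    degree [i] part of [r *: x] itself. *)
Lemma veronese_ext_graded : graded_submodule veronese_ext.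
Proof.
split=> [|j x Ux r i ni].
  split=> [r i _|x y Ux Uy r i ni|a x Ux r i ni].
  - by rewrite scaler0 (grading0 gM).
  - by rewrite scalerDr (gradingD gM); apply: UD; [apply: Ux|apply: Uy].
  - by rewrite scalerA; apply: Ux.
have [_ cc _] := gM; have [_ _ /(_ r)[s _ ->]] := gR.
rewrite scaler_suml (grading_sum gM); apply: big_ind => // k _.
have hk := grading_homog gR k r.
rewrite (comp_scalel _ _ hk) cc; case: eqP => [<-|_]; last by rewrite scaler0.
by rewrite -(comp_scalel _ _ hk); apply: Ux.
Qed.

(** One direction takes [r = 1]. For the other, a homogeneous [r] either lies in the Veronese
    subring, which preserves [U], or moves [x] out of all degrees divisible by [n]. *)
Lemma veronese_extP x : x \in veronese_pred (gmod_comp M) n ->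
  veronese_ext x <-> U x.
Proof.
move=> /veronese_predP xP; split=> Ux.
  have [_ _ /(_ x)[s _ ->]] := gM; apply: big_ind => // i _.
  have [ni|/xP-> //] := boolP (n%:Z %| i)%Z.
  by rewrite -[x]scale1r; apply: Ux.
move=> r i ni; have [_ _ /(_ r)[s _ ->]] := gR.
rewrite scaler_suml (grading_sum gM); apply: big_ind => // k _.
have hk := grading_homog gR k r; rewrite (comp_scalel _ _ hk).
have [nk|nk] := boolP (n%:Z %| k)%Z.
  apply: UZ; last exact: Uc.
  apply/veronese_predP => j nj; apply: (homog_comp gR hk).
  by apply: contra nj => /eqP ->.
rewrite xP ?scaler0 //; apply: contra nk => nik.
by rewrite -[k](subKr i) rpredB.
Qed.

End Extension.

Lemma veronese_extS (M : gradedModule R) (U V : set M) :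
  U `<=` V -> veronese_ext U `<=` veronese_ext V.
Proof. by move=> UV x Ux r i ni; apply/UV/Ux. Qed.

Section ModuleExtension.
Variables (M : gradedModule R) (U : set (veroneseModule n M)).
Hypothesis gU : graded_submodule U.

Definition veronese_mod_ext := veronese_ext (@veronese_mod_val R n M @` U).

Lemma veronese_mod_image_closed : let V := @veronese_mod_val R n M @` U in
  [/\ V 0, forall x y, V x -> V y -> V (x + y),
      forall a x, a \in P -> V x -> V (a *: x) &
      forall i x, V x -> V (gmod_comp M i x)].
Proof.
have [[U0 UD UZ] Uc] := gU; split.
- by exists 0.
- by move=> _ _ [x Ux <-] [y Uy <-]; exists (x + y) => //; apply: UD.
- move=> a _ aP [x Ux <-]; exists (VeroneseRing aP *: x) => //; exact: UZ.
- move=> i _ [x Ux <-]; exists (gmod_comp (veroneseModule n M) i x) => //.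
  exact: Uc.
Qed.

Lemma veronese_mod_ext_graded : graded_submodule veronese_mod_ext.
Proof.
by have [? ? ? ?] := veronese_mod_image_closed; apply: veronese_ext_graded.
Qed.

Lemma veronese_mod_extP x : veronese_mod_ext (veronese_mod_val x) <-> U x.
Proof.
have [? ? ? ?] := veronese_mod_image_closed.
apply: (iff_trans (veronese_extP _ _ _ _ (veronese_mod_valP x))) => //.
by split=> [[y Uy /val_inj <-]|Ux] //; exists x.
Qed.

End ModuleExtension.

(** Extension is monotone, and [veronese_mod_extP] recovers [U] from its extension. *)
Lemma veronese_artinian (M : gradedModule R) :
  star_artinian M -> star_artinian (veroneseModule n M).
Proof.
move=> aM U gU dU.
have [t|t|t0 t0P] := aM (fun t => veronese_mod_ext (U t)).
- exact: veronese_mod_ext_graded.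
- by apply: veronese_extS => _ [x /dU Ux <-]; exists x.
exists t0 => t /t0P e; apply/seteqP; split=> x.
  by move/(veronese_mod_extP (gU t)); rewrite e => /(veronese_mod_extP (gU t0)).
by move/(veronese_mod_extP (gU t0)); rewrite -e => /(veronese_mod_extP (gU t)).
Qed.

Section IdealExtension.
Variable I : set (veroneseRing R n).
Hypothesis gI : graded_ideal I.

Definition veronese_ideal_ext : set R :=
  veronese_ext (@veronese_ring_val R n @` I : set (regularModule R)).

Lemma veronese_ring_image_closed :
  let V := @veronese_ring_val R n @` I : set (regularModule R) in
  [/\ V 0, forall x y, V x -> V y -> V (x + y),
      forall a x, a \in P -> V x -> V (a *: x) &
      forall i x, V x -> V (gmod_comp (regularModule R) i x)].
Proof.
have [[I0 ID IZ] Ic] := gI; split.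
- by exists 0.
- by move=> _ _ [x Ix <-] [y Iy <-]; exists (x + y) => //; apply: ID.
- by move=> a _ aP [x Ix <-]; exists (VeroneseRing aP * x) => //; apply: IZ.
- move=> i _ [x Ix <-]; exists (@gring_comp (veroneseRing R n) i x) => //.
  exact: Ic.
Qed.

Lemma veronese_ideal_ext_graded : graded_ideal veronese_ideal_ext.
Proof.
by have [? ? ? ?] := veronese_ring_image_closed; apply: veronese_ext_graded.
Qed.

Lemma veronese_ideal_extP x : veronese_ideal_ext (veronese_ring_val x) <-> I x.
Proof.
have [? ? ? ?] := veronese_ring_image_closed.
apply: (iff_trans (veronese_extP (M := regularModule R) _ _ _ _
  (veronese_ring_valP x))) => //.
by split=> [[y Iy /val_inj <-]|Ix] //; exists x.
Qed.

End IdealExtension.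

Lemma veronese_graded_acc : graded_acc R -> graded_acc (veroneseRing R n).
Proof.
move=> acc I gI aI.
have [t|t|t0 t0P] := acc (fun t => veronese_ideal_ext (I t)).
- exact: veronese_ideal_ext_graded.
- by apply: (@veronese_extS (regularModule R)) => _ [x /aI Ix <-]; exists x.
exists t0 => t /t0P e; apply/seteqP; split=> x.
  by move/(veronese_ideal_extP (gI t)); rewrite e => /(veronese_ideal_extP (gI t0)).
by move/(veronese_ideal_extP (gI t0)); rewrite -e => /(veronese_ideal_extP (gI t)).
Qed.

Definition veronese_ideal (I : set R) : set (veroneseRing R n) :=
  [set x | I (veronese_ring_val x)].

Lemma veronese_ideal_graded I :
  graded_ideal I -> graded_ideal (veronese_ideal I).
Proof.
move=> [[I0 ID IZ] Ic]; split=> [|i x]; last exact: Ic.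
by split=> // [x y|a x]; [apply: ID|apply: IZ].
Qed.

(** The inverse in [R] has degree [- i], again divisible by [n], so it lies in the Veronese
    subring. *)
Lemma veronese_unit (m : set R) i (a : veroneseRing R n) :
  graded_acc R -> star_local m ->
  homog (@gring_comp (veroneseRing R n)) i a -> ~ veronese_ideal m a ->
  exists b, b * a = 1.
Proof.
move=> acc ml /veronese_ring_homog ha nma.
have [b hb ba] := star_local_unit acc ml ha nma.
(* Otherwise [a] has no component in its own degree [i], so it is zero and lies in [m]. *)
have ni : (n%:Z %| i)%Z.
  apply: contrapT => /negP ni; apply: nma; rewrite /veronese_ideal /= -ha.
  have /veronese_predP-> // := veronese_ring_valP a.
  by have [[[[[]]]]] := ml.
have bP : b \in P.
  apply/veronese_predP => j nj; apply: (homog_comp (gring_grading R) hb).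
  by apply: contra nj => /eqP ->; rewrite rpredN.
by exists (VeroneseRing bP); apply: val_inj.
Qed.

End Veronese.

(** * Nonzero summands and the finiteness of the Bass numbers *)

Lemma hull_of_prime_neq0 (S : gradedRing) (p : set S) (E : gradedModule S) :
  graded_prime p -> is_hull_of_prime p E -> exists y : E, y != 0.
Proof.
move=> [[gp pT] _] [Q [q [h [[_ _ kq] [_ hinj _ _]]]]].
exists (h (q 1)); apply/eqP => h0; apply: pT; apply: graded_ideal_setT => //.
by apply: (proj1 (kq _)); apply: hinj; rewrite h0 linear0.
Qed.

Theorem lemma4p10 (R : gradedRing) (m : set R) (n : nat) (M : gradedModule R)
  (R_noetherian : noetherian R)
  (R_star_local : star_local m)
  (k_field : quotient_field m)
  (n_ge1 : (1 <= n)%N)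
  (M_artinian : star_artinian M) :
  finite_star_bass_numbers (veroneseModule n M).
Proof.
have acc := noetherian_graded_acc R_noetherian.
move=> E eps d res i J P z [F [f [pP hF sumf]]] p _.
have aE : star_artinian (E i).
  (* Over the Veronese ring, the contraction of [m] takes the place of [m]. *)
  apply: (star_artinian_resolution (m := veronese_ideal (n := n) m) _ _ _ _ res).
  - exact: veronese_graded_acc.
  - by apply: veronese_ideal_graded; have [[[]]] := R_star_local.
  - exact: star_local_proper R_star_local.
  - by move=> j a; apply: veronese_unit.
  - exact: veronese_artinian.
(* The whole index set is finite, which bounds the multiplicities of all primes at once. *)
apply: (@sub_finite_set _ _ [set: J]) => //.
apply: (star_artinian_finite_direct_sum sumf aE) => j.
(* A shift changes only the grading, so a nonzero element of [F j] is one of its shift. *)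
exact: hull_of_prime_neq0 (hF j).
Qed.
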